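(* Let $n,p$ be positive integers and let $\sigma>0$. Let $\mu\in\mathbb{R}^n$ and let $\mathbb{X}$ be any (deterministic) real matrix of size $n\times p$. Let $y=\mu+\xi$, where the random vector $\xi$ in $\mathbb{R}^n$ satisfies $\mathbb{E}[\exp(v^T\xi)]\le \exp(\sigma^2|v|_2^2/2)$ for all $v\in\mathbb{R}^n$. Let $\hat\sigma^2\ge0$ be any real-valued estimator and let $\delta=\mathbb{P}(\hat\sigma^2<\sigma^2)$. Let $\lambda_0>\dots>\lambda_K$ be the knots of the Lasso path (defined in the context), let $$\hat F=\{\mathrm{supp}(\hat\beta^{L}_{\lambda_j}):\ j=0,\dots,K\}$$ be the family of all supports that appear on the Lasso path, and let $\hat\mu^Q$ be the estimator built from $\hat F$ and $\hat\sigma^2$ defined in the context. Then for all $x>0$, the estimator $\hat\mu^Q$ satisfies, with probability greater than $1-\delta-2\exp(-x)$, $$\|\hat\mu^{Q}-\mu\|^2\le \min_{\lambda>0}\left(\|\mathbb{X}\hat\beta^{L}_\lambda-\mu\|^2+\frac{\hat\sigma^2}{n}\left(24+96|\hat\beta^{L}_\lambda|_0\log\left(\frac{ep}{|\hat\beta^{L}_\lambda|_0\vee 1}\right)\right)\right)+\frac{22\sigma^2x}{n},$$ where for all $\lambda>0$, $\hat\beta^L_\lambda$ is the Lasso estimator with tuning parameter $\lambda$.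
   Context: Notation: $|\cdot|_2$ is the Euclidean norm, $|\beta|_1=\sum_j|\beta_j|$, $\|u\|^2=\frac1n|u|_2^2$ for $u\in\mathbb{R}^n$, $a\vee b=\max(a,b)$; for $\beta\in\mathbb{R}^p$, $\mathrm{supp}(\beta)=\{k:\beta_k\neq0\}$ and $|\beta|_0$ is the number of nonzero coefficients of $\beta$. An estimator is a quantity depending on the data $y$. No relation between $\mu$ and $\mathbb{X}$ is assumed. Lasso: for a tuning parameter $\lambda$, $\hat\beta^L_\lambda$ is any solution of the convex minimization problem $$\hat\beta^{L}_\lambda\in\operatorname*{argmin}_{\beta\in\mathbb{R}^p}\ \frac1{2n}|y-\mathbb{X}\beta|_2^2+\lambda|\beta|_1 .$$ Knots of the Lasso path: for a given observation $y$, there exist a positive integer $K$ and a finite sequence $\lambda_0>\lambda_1>\dots>\lambda_K=0$ (the knots) such that $\hat\beta^L_\lambda=0$ for all $\lambda>\lambda_0$, and such that $\mathrm{supp}(\hat\beta^L_\lambda)=\mathrm{supp}(\hat\beta^L_{\lambda_k})$ for all $\lambda\in(\lambda_{k+1},\lambda_k)$. These properties of the Lasso path are recalled in the paper as known. A support is a subset $T\subset\{1,\dots,p\}$; $|T|$ is its cardinality and $\Pi_T\in\mathbb{R}^{n\times n}$ is the orthogonal projection onto the linear span of the columns of $\mathbb{X}$ with indices in $T$. Weights: for every support $T$, $$\pi_T=\left(H_p\binom{p}{|T|}e^{|T|}\right)^{-1},\qquad H_p=\frac{e-e^{-p}}{e-1}.$$ Estimator $\hat\mu^Q$: let $\hat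 M$ be the cardinality of $\hat F$, write $\hat F=\{\hat T_1,\dots,\hat T_{\hat M}\}$, $\hat\mu_j=\Pi_{\hat T_j}y$, and $\hat\mu_\theta=\sum_{j=1}^{\hat M}\theta_j\hat\mu_j$ for $\theta\in\mathbb{R}^{\hat M}$. Let $\Lambda^{\hat M}=\{\theta\in\mathbb{R}^{\hat M}:\ \sum_j\theta_j=1,\ \theta_j\ge0\ \forall j\}$ and, for $\theta\in\Lambda^{\hat M}$, $$H(\theta)=|\hat\mu_\theta-y|_2^2+\frac12\sum_{j=1}^{\hat M}\theta_j|\hat\mu_j-\hat\mu_\theta|_2^2+26\hat\sigma^2\sum_{j=1}^{\hat M}\theta_j\log\frac1{\pi_{\hat T_j}}.$$ Then $\hat\mu^Q=\hat\mu_{\hat\theta}$, where $\hat\theta$ is any minimizer of $H$ over $\Lambda^{\hat M}$.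
   Formalization: The recalled knot property cannot hold when X^T y is nonzero (λ_K=0 would fail); here the support on each interval (λ_{k+1},λ_k) is constant and equals the support at λ_k or at λ_{k+1}, so that F̂ still contains every support on the path. *)

(* Defs.v *)
(* MathComp / MathComp-Analysis *)
From HB Require Import structures.
From mathcomp Require Import all_boot all_order all_algebra.
From mathcomp Require Import all_classical all_reals all_analysis.
Set Implicit Arguments.
Unset Strict Implicit.
Unset Printing Implicit Defensive.
Import Order.TTheory GRing.Theory Num.Theory.
Import numFieldNormedType.Exports.
Local Open Scope classical_set_scope.
Local Open Scope ring_scope.

Section Vectors.
Context {R : realType}.

Definition dotv n (u v : 'cV[R]_n) : R := \sum_(i < n) u i 0 * v i 0.

Definition norm2 n (u : 'cV[R]_n) : R := Num.sqrt (\sum_(i < n) u i 0 ^+ 2).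

Definition norm1 n (u : 'cV[R]_n) : R := \sum_(i < n) `|u i 0|.

(* The squared norm in the 1/n normalization. *)
Definition sqnormn n (u : 'cV[R]_n) : R := n%:R^-1 * norm2 u ^+ 2.

Definition supp p (b : 'cV[R]_p) : {set 'I_p} := [set k | b k 0 != 0]%SET.

Definition norm0 p (b : 'cV[R]_p) : nat := #|supp b|.

End Vectors.

Section OrthogonalProjection.
Context {R : realType} {n p : nat}.
Implicit Types (X : 'M[R]_(n, p)) (S : {set 'I_p}).

Definition cols X S : 'M[R]_(n, #|S|) := colsub (fun j : 'I_#|S| => enum_val j) X.

(* [proj_mx] acts on row vectors. The row space of [kermx (cols X S)] is the
   set of rows u with [u *m cols X S = 0], that is, the orthogonal complement
   of the span of the selected columns. See [projS_sub] and [projS_orth]. *)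
Definition projS X S : 'M[R]_n :=
  (proj_mx <<(cols X S)^T>>%MS (kermx (cols X S)))^T.

Lemma sub_orth_eq0 (m : nat) (A : 'M[R]_(n, m)) (u : 'rV[R]_n) :
  (u <= A^T)%MS -> u *m A = 0 -> u = 0.
Proof.
move=> /submxP[w uE] uA.
have uu : u *m u^T = 0 by rewrite {2}uE trmx_mul trmxK mulmxA uA mul0mx.
have : \sum_(i < n) u 0 i ^+ 2 == 0.
  move/matrixP: uu => /(_ 0 0); rewrite !mxE => uu; apply/eqP; rewrite -[RHS]uu.
  by apply: eq_bigr => i _; rewrite mxE expr2.
rewrite psumr_eq0 => [/allP u0|i _]; last exact: sqr_ge0.
apply/rowP => i; rewrite mxE.
by have := u0 i (mem_index_enum i); rewrite /= sqrf_eq0 => /eqP.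
Qed.

Lemma capmx_orth X S : (<<(cols X S)^T>> :&: kermx (cols X S) = 0)%MS.
Proof.
apply/eqP/rowV0P => u; rewrite sub_capmx genmxE => /andP[uS /sub_kermxP].
exact: sub_orth_eq0.
Qed.

Lemma projS_sub X S (u : 'cV[R]_n) : ((projS X S *m u)^T <= (cols X S)^T)%MS.
Proof.
rewrite trmx_mul trmxK.
by apply: (submx_trans (proj_mx_sub _ _ _)); rewrite genmxE.
Qed.

Lemma projS_orth X S (u : 'cV[R]_n) : (cols X S)^T *m (u - projS X S *m u) = 0.
Proof.
apply: trmx_inj; rewrite trmx_mul trmxK linearB /= trmx_mul trmxK trmx0.
apply/sub_kermxP; apply: proj_mx_compl_sub.
suff full : (1%:M <= <<(cols X S)^T>> + kermx (cols X S))%MS.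
  exact: submx_trans (submx1 _) full.
rewrite sub1mx /row_full mxrank_disjoint_sum ?capmx_orth //.
by rewrite genmxE mxrank_tr mxrank_ker subnKC ?rank_leq_row.
Qed.

End OrthogonalProjection.

Section Lasso.
Context {R : realType} {n p : nat}.
Implicit Types (X : 'M[R]_(n, p)) (y : 'cV[R]_n) (b : 'cV[R]_p).

Definition lasso_obj X y (l : R) b : R :=
  (2 * n%:R)^-1 * norm2 (y - X *m b) ^+ 2 + l * norm1 b.

Definition lasso_sol X y (l : R) b : Prop :=
  forall b', lasso_obj X y l b <= lasso_obj X y l b'.

(* [lam 0 > ... > lam K = 0] are knots of the path [beta]. On each open
   interval the support is constant, and equal to the support at one of the
   two end points: at the lower one when variables enter at the upper one, and
   at the upper one when variables leave at the lower one. Requiring the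
   support at the upper end point on all intervals would be unsatisfiable for
   Lasso solutions as soon as [X^T *m y != 0], since the solution is null at
   the largest knot. *)
Definition lasso_knots (beta : R -> 'cV[R]_p) (K : nat) (lam : nat -> R) : Prop :=
  [/\ (0 < K)%N,
      lam K = 0,
      forall k, (k < K)%N -> lam k.+1 < lam k,
      forall l, lam 0%N < l -> beta l = 0 &
      forall k, (k < K)%N ->
        (forall l, lam k.+1 < l < lam k -> supp (beta l) = supp (beta (lam k))) \/
        (forall l, lam k.+1 < l < lam k -> supp (beta l) = supp (beta (lam k.+1)))].

Definition knot_supports (beta : R -> 'cV[R]_p) (K : nat) (lam : nat -> R) :
    {set {set 'I_p}} :=
  [set supp (beta (lam (k : 'I_K.+1))) | k : 'I_K.+1]%SET.

End Lasso.

Section QAggregation.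
Context {R : realType} {n p : nat}.
Implicit Types (X : 'M[R]_(n, p)) (y : 'cV[R]_n) (F : {set {set 'I_p}}).

Definition Hp : R := (expR 1 - expR (- p%:R)) / (expR 1 - 1).

Definition weight (S : {set 'I_p}) : R :=
  (Hp * 'C(p, #|S|)%:R * expR #|S|%:R)^-1.

Definition simplex M (theta : 'rV[R]_M) : Prop :=
  \sum_(j < M) theta 0 j = 1 /\ forall j, 0 <= theta 0 j.

Definition muj X y F (j : 'I_#|F|) : 'cV[R]_n := projS X (enum_val j) *m y.

Definition mutheta X y F (theta : 'rV[R]_#|F|) : 'cV[R]_n :=
  \sum_(j < #|F|) theta 0 j *: muj X y j.

Definition Hcrit X y F (s2 : R) (theta : 'rV[R]_#|F|) : R :=
  norm2 (mutheta X y theta - y) ^+ 2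
  + 2^-1 * \sum_(j < #|F|) theta 0 j * norm2 (muj X y j - mutheta X y theta) ^+ 2
  + 26 * s2 * \sum_(j < #|F|) theta 0 j * ln (1 / weight (enum_val j)).

Definition is_muQ X y F (s2 : R) (mu : 'cV[R]_n) : Prop :=
  exists theta : 'rV[R]_#|F|,
    [/\ simplex theta,
        forall theta' : 'rV[R]_#|F|, simplex theta' -> Hcrit X y s2 theta <= Hcrit X y s2 theta' &
        mu = mutheta X y theta].

(* The loss of [X *m b] plus a sparsity penalty: the quantity minimized over
   the tuning parameter, [b] being the Lasso estimator. *)
Definition lasso_risk X (mu : 'cV[R]_n) (s2 : R) (b : 'cV[R]_p) : R :=
  sqnormn (X *m b - mu)
  + s2 / n%:R *
    (24 + 96 * (norm0 b)%:R * ln (expR 1 * p%:R / (maxn (norm0 b) 1)%:R)).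

End QAggregation.

(* Main.v *)
Require Import Defs.
From mathcomp Require Import all_boot all_order all_algebra.
From mathcomp Require Import all_classical all_reals all_analysis.
From mathcomp Require Import measurable_realfun ring lra.
Import Order.TTheory GRing.Theory Num.Theory.
Import numFieldNormedType.Exports.
Set Implicit Arguments.
Unset Strict Implicit.
Unset Printing Implicit Defensive.
Local Open Scope classical_set_scope.
Local Open Scope ring_scope.

(** First-order optimality of theta over the simplex bounds |muQ - mu|^2, for
    every support T in the family, by |Pi_T y - mu|^2 + pen_T plus a
    theta-average over the supports S of the family of
    [2 xi.(Pi_S y - Pi_T y) - |Pi_S y - Pi_T y|^2 / 2 - pen_S]. Adding the
    variance |Pi_T xi|^2 of the least squares estimator on T, the noise of the
    pair (S, T) is at most [3 |Pi_S xi|^2 + 2 a.xi - |a|^2 / 4] with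
    [a = (Pi_S - Pi_T) mu]: only one chi-square term is left, and the linear
    term is compensated. Its exponential moment at 1 / (16 sigma^2) is at most
    [exp (|S| / 2)]. Averaging over all pairs with the prior weights gives one
    random variable of mean at most 1, so that Markov's inequality controls all
    pairs at once, hence the random family, outside an event of probability
    at most exp(-x). *)

(** * Dot products and orthogonal projections *)

Section DotProduct.
Context {R : realType} {n : nat}.
Implicit Types (u v w : 'cV[R]_n) (a : R).

Lemma dotvE u v : dotv u v = (u^T *m v) 0 0.
Proof. by rewrite mxE; apply: eq_bigr => i _; rewrite mxE. Qed.

Lemma dotvC u v : dotv u v = dotv v u.
Proof. by apply: eq_bigr => i _; rewrite mulrC. Qed.

Lemma dotvDl u v w : dotv (u + v) w = dotv u w + dotv v w.
Proof. by rewrite !dotvE linearD mulmxDl mxE. Qed.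

Lemma dotvZl a u w : dotv (a *: u) w = a * dotv u w.
Proof. by rewrite !dotvE linearZ -scalemxAl mxE. Qed.

Lemma dotvNl u w : dotv (- u) w = - dotv u w.
Proof. by rewrite -scaleN1r dotvZl mulN1r. Qed.

Lemma dotv0l w : dotv 0 w = 0.
Proof. by rewrite -(scale0r w) dotvZl mul0r. Qed.

Lemma dotvDr u v w : dotv u (v + w) = dotv u v + dotv u w.
Proof. by rewrite dotvC dotvDl !(dotvC u). Qed.

Lemma dotvZr a u w : dotv u (a *: w) = a * dotv u w.
Proof. by rewrite dotvC dotvZl dotvC. Qed.

Lemma dotvNr u w : dotv u (- w) = - dotv u w.
Proof. by rewrite dotvC dotvNl dotvC. Qed.

Lemma dotv_suml (I : Type) (r : seq I) (Q : pred I) (F : I -> 'cV[R]_n) w :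
  dotv (\sum_(i <- r | Q i) F i) w = \sum_(i <- r | Q i) dotv (F i) w.
Proof.
apply: (big_morph (fun u => dotv u w)) => [u v|]; first exact: dotvDl.
exact: dotv0l.
Qed.

Lemma dotv_mulmx (M : 'M[R]_n) u v : dotv (M *m u) v = dotv u (M^T *m v).
Proof. by rewrite !dotvE trmx_mul mulmxA. Qed.

Lemma dotv_ge0 u : 0 <= dotv u u.
Proof. by apply: sumr_ge0 => i _; rewrite -expr2 sqr_ge0. Qed.

Lemma norm2_sqr u : norm2 u ^+ 2 = dotv u u.
Proof.
rewrite sqr_sqrtr; first by apply: eq_bigr => i _; rewrite expr2.
by apply: sumr_ge0 => i _; rewrite sqr_ge0.
Qed.

Lemma dotv_eq0 u : dotv u u = 0 -> u = 0.
Proof.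
move=> uu; have := @sub_orth_eq0 R n 1 u u^T (submx_refl _).
move=> H; apply: trmx_inj; rewrite trmx0; apply: H.
by apply/matrixP => i j; rewrite !ord1 -dotvE uu mxE.
Qed.

End DotProduct.

Definition dotv_lin := (@dotvDl, @dotvDr, @dotvZl, @dotvZr, @dotvNl, @dotvNr).

Definition orthproj {R : realType} {n : nat} (M : 'M[R]_n) :=
  M^T = M /\ M *m M = M.

Section OrthProj.
Context {R : realType} {n : nat}.
Implicit Types (M : 'M[R]_n) (u v : 'cV[R]_n).

Lemma dotv_proj M u : orthproj M -> dotv (M *m u) u = dotv (M *m u) (M *m u).
Proof. by case=> sM iM; rewrite [RHS]dotv_mulmx sM mulmxA iM dotvC. Qed.

Lemma dotv_proj_le M u : orthproj M -> dotv (M *m u) (M *m u) <= dotv u u.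
Proof.
move=> oM; have := dotv_ge0 (u - M *m u).
by rewrite !dotv_lin (dotvC u (M *m u)) dotv_proj//; lra.
Qed.

Lemma mxtrace_proj M : orthproj M -> \tr M = \sum_i \sum_j M i j ^+ 2.
Proof.
case=> sM iM; rewrite -{1}iM; apply: eq_bigr => i _; rewrite mxE.
by apply: eq_bigr => j _; rewrite -{2}sM mxE expr2.
Qed.

(** Idempotence makes the factors of a rank factorization multiply, in the reverse order, to the
    identity of size [\rank M]; the trace is cyclic. *)
Lemma mxtrace_idem M : M *m M = M -> \tr M = (\rank M)%:R.
Proof.
move=> iM; have cK : row_base M *m col_base M = 1%:M.
  apply: (row_free_inj (row_base_free M)); apply: (row_full_inj (col_base_full M)).
  by rewrite mul1mx mulmx_base -mulmxA (mulmxA (col_base M)) mulmx_base.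
by rewrite -{1}(mulmx_base M) mxtrace_mulC cK mxtrace1.
Qed.

End OrthProj.

(** * Projection onto the span of the selected columns *)

Section SupportProjection.
Context {R : realType} {n p : nat} (X : 'M[R]_(n, p)) (S : {set 'I_p}).

Lemma projS_cols : (cols X S)^T *m projS X S = (cols X S)^T.
Proof.
suff H : forall u : 'cV[R]_n,
    (cols X S)^T *m projS X S *m u = (cols X S)^T *m u.
  apply/matrixP => i j; have := H (delta_mx j 0).
  by rewrite -!colE => /colP/(_ i) Hi; move: Hi; rewrite mxE => ->; rewrite mxE.
by move=> u; have /eqP := projS_orth X S u; rewrite mulmxBr subr_eq0 mulmxA => /eqP.
Qed.

Lemma projS_factor : exists W : 'M[R]_(#|S|, n), projS X S = cols X S *m W.
Proof.
have : ((projS X S)^T <= (cols X S)^T)%MS.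
  apply/row_subP => i; have := projS_sub X S (delta_mx i 0).
  by rewrite -colE tr_col.
by case/submxP => W WE; exists W^T; rewrite -[LHS]trmxK WE trmx_mul trmxK.
Qed.

(** With A the selected columns and P = A W, [projS_cols] gives P^T P = W^T A^T P = W^T A^T = P^T.
    So P^T is symmetric, and P is idempotent. *)
Lemma projS_orthproj : orthproj (projS X S).
Proof.
have [W PE] := projS_factor.
have PP : (projS X S)^T *m projS X S = (projS X S)^T.
  by rewrite {1 3}PE trmx_mul -mulmxA projS_cols.
have sP : (projS X S)^T = projS X S.
  by rewrite -[RHS]trmxK -PP trmx_mul trmxK.
by split=> //; move: PP; rewrite sP.
Qed.

Lemma mxtrace_projS : \tr (projS X S) <= #|S|%:R.
Proof.
rewrite mxtrace_idem ?ler_nat; last by case: projS_orthproj.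
by have [W ->] := projS_factor; rewrite (leq_trans (mxrankM_maxl _ _))// rank_leq_col.
Qed.

Lemma projS_fix (b : 'cV[R]_p) : supp b \subset S ->
  projS X S *m (X *m b) = X *m b.
Proof.
move=> /fintype.subsetP bS; rewrite mulmxA.
have PA : projS X S *m cols X S = cols X S.
  have [sP _] := projS_orthproj.
  by apply: trmx_inj; rewrite trmx_mul sP projS_cols.
apply/colP => i; rewrite !mxE; apply: eq_bigr => k _.
have [->|bk] := eqVneq (b k 0) 0; first by rewrite !mulr0.
have kS : k \in S by apply: bS; rewrite inE.
move/matrixP: PA => /(_ i (enum_rank_in kS k)); rewrite !mxE enum_rankK_in// => PA.
by congr (_ * _); rewrite -[RHS]PA; apply: eq_bigr => j _; rewrite !mxE enum_rankK_in.
Qed.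

(** Since the projection fixes [X *m b], the left residual is the component of [X *m b - u]
    orthogonal to the span. *)
Lemma projS_best (b : 'cV[R]_p) (u : 'cV[R]_n) : supp b \subset S ->
  norm2 (projS X S *m u - u) ^+ 2 <= norm2 (X *m b - u) ^+ 2.
Proof.
move=> bS; rewrite !norm2_sqr; set P := projS X S.
have -> : P *m u - u = (X *m b - u) - P *m (X *m b - u).
  by rewrite mulmxBr projS_fix// opprB [RHS]addrC addrA subrK.
move: (X *m b - u) => w; rewrite !dotv_lin (dotvC w) dotv_proj; last exact: projS_orthproj.
by have := dotv_ge0 (P *m w); lra.
Qed.

End SupportProjection.

(** * Exponential moments of a sub-Gaussian vector *)

Section GaussianIntegral.
Context {R : realType}.

(** Completing the square turns the integrand into a multiple of the normal density of mean s^2 c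
    and standard deviation s. *)
Lemma gauss_exp_quad (s c : R) : 0 < s ->
  (\int[lebesgue_measure]_x
     (normal_pdf 0 1 x * expR (c * x + (1 - s ^- 2) / 2 * x ^+ 2))%:E
   = (s * expR (s ^+ 2 * c ^+ 2 / 2))%:E)%E.
Proof.
move=> s0; have sN0 : s != 0 by rewrite gt_eqF.
under eq_integral => x _.
  have -> : normal_pdf 0 1 x * expR (c * x + (1 - s ^- 2) / 2 * x ^+ 2) =
      s * expR (s ^+ 2 * c ^+ 2 / 2) * normal_pdf (s ^+ 2 * c) s x.
    have peakE : normal_peak 1 = s * normal_peak s.
      rewrite /normal_peak expr1n mul1r -mulrnAr sqrtrM ?sqr_ge0//.
      by rewrite sqrtr_sqr gtr0_norm// invfM mulrA divff// mul1r.
    rewrite !normal_pdfE ?oner_neq0// peakE -!mulrA; congr (_ * _).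
    rewrite [RHS]mulrCA; congr (_ * _).
    rewrite /normal_fun -!expRD; congr expR.
    by field.
  rewrite EFinM; over.
rewrite ge0_integralZl_EFin//=.
- by rewrite integral_normal_pdf mule1.
- by move=> x _; rewrite lee_fin normal_pdf_ge0.
- by apply/measurable_EFinP; exact: measurable_normal_pdf.
- by rewrite mulr_ge0 ?expR_ge0 ?ltW.
Qed.

End GaussianIntegral.

(** * Quadratic forms of a sub-Gaussian vector *)

Section SubGaussian.
Context {R : realType} {n : nat}.

Lemma measurable_dotv d (T : measurableType d) (f g : T -> 'cV[R]_n) :
  (forall i, measurable_fun setT (fun w => f w i 0)) ->
  (forall i, measurable_fun setT (fun w => g w i 0)) ->
  measurable_fun setT (fun w => dotv (f w) (g w)).
Proof.
move=> mf mg; apply: measurable_sum => i.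
exact: measurable_funM.
Qed.

Lemma measurable_mulmx d (T : measurableType d) (M : 'M[R]_n) (f : T -> 'cV[R]_n) :
  (forall i, measurable_fun setT (fun w => f w i 0)) ->
  forall i, measurable_fun setT (fun w => (M *m f w) i 0).
Proof.
move=> mf i; under eq_fun do rewrite mxE.
by apply: measurable_sum => j; apply: measurable_funM.
Qed.

(** Any nonzero column of M lies in its image; normalized, it is the direction u to remove, and M'
    projects onto the orthogonal complement of u in that image. *)
Lemma orthproj_peel (M : 'M[R]_n) : orthproj M -> M != 0 ->
  exists u : 'cV[R]_n, let M' := M - u *m u^T in
  [/\ orthproj M', \tr M' = \tr M - 1, dotv u u = 1, M' *m u = 0 &
      forall v, dotv (M *m v) (M *m v) = dotv (M' *m v) (M' *m v) + dotv u v ^+ 2].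
Proof.
move=> oM MN0; have [sM iM] := oM.
have [i w0] : exists i, col i M != 0.
  apply: contrapT => /forallNP M0; case/eqP: MN0; apply/matrixP => i j.
  by have /negP/negPn/eqP/colP/(_ i) := M0 j; rewrite !mxE.
set w := col i M in w0.
have ww : 0 < dotv w w.
  by rewrite lt_neqAle dotv_ge0 andbT eq_sym; apply: contra w0 => /eqP/dotv_eq0 ->.
pose u := (Num.sqrt (dotv w w))^-1 *: w.
have uu : dotv u u = 1.
  rewrite dotvZl dotvZr mulrA -expr2 exprVn sqr_sqrtr ?(ltW ww)// mulVf//.
  by rewrite gt_eqF.
have Mu : M *m u = u.
  have Mw : M *m w = w by rewrite /w colE mulmxA iM.
  by rewrite -scalemxAr Mw.
have uM : u^T *m M = u^T by apply: trmx_inj; rewrite trmx_mul sM trmxK.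
have uTu : u^T *m u = 1%:M.
  by apply/matrixP => a b; rewrite !ord1 -dotvE uu !mxE.
have oM' : orthproj (M - u *m u^T).
  split; first by rewrite linearB /= trmx_mul trmxK sM.
  rewrite mulmxBl !mulmxBr iM !mulmxA Mu -(mulmxA u) uM -(mulmxA u) uTu mulmx1.
  by rewrite subrr subr0.
exists u; split => //.
- by rewrite raddfB /= (mxtrace_mulC u) uTu mxtrace1.
- by rewrite mulmxBl Mu -mulmxA uTu mulmx1 subrr.
move=> v; rewrite -!dotv_proj// mulmxBl dotvDl dotvNl -mulmxA.
have -> : u^T *m v = (dotv u v)%:M by apply/matrixP => a b; rewrite !ord1 -dotvE mxE.
by rewrite mul_mx_scalar dotvZl expr2; lra.
Qed.

Context d (Omega : measurableType d) (P : probability Omega R).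
Variables (z : Omega -> 'cV[R]_n).
Hypothesis z_meas : forall i, measurable_fun setT (fun w => z w i 0).
Hypothesis z_subg : forall v,
  (\int[P]_w (expR (dotv v (z w)))%:E <= (expR (dotv v v / 2))%:E)%E.

(* Induction on the trace, i.e. on the dimension of the image: peel off one
   direction u and write exp((1 - s^-2)/2 (u.z)^2) as the standard Gaussian
   integral of exp(b x (u.z)) with b^2 = 1 - s^-2, which Tonelli's theorem
   turns into a shift of v. *)
Lemma subgaussian_proj_mgf (s : R) (m : nat) (M : 'M[R]_n) (v : 'cV[R]_n) :
  1 <= s -> orthproj M -> \tr M <= m%:R ->
  (\int[P]_w (expR (dotv v (z w)
       + (1 - s ^- 2) / 2 * dotv (M *m z w) (M *m z w)))%:E
   <= (s ^+ m * expR (dotv v v / 2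
       + (s ^+ 2 - 1) / 2 * dotv (M *m v) (M *m v)))%:E)%E.
Proof.
move=> s1; have s0 : 0 < s by lra.
elim: m M v => [|m IH] M v oM trM.
  (* The trace of a projection is the sum of its squared entries, so a nonpositive trace forces M =
     0. *)
  have -> : M = 0.
    apply/eqP; move: trM; rewrite mxtrace_proj// => trM.
    have sq0 i : 0 <= \sum_j M i j ^+ 2 by apply: sumr_ge0 => j _; rewrite sqr_ge0.
    apply/eqP/matrixP => i j; rewrite mxE; apply/eqP; rewrite -sqrf_eq0 eq_le sqr_ge0 andbT.
    apply: le_trans trM; rewrite (bigD1 i)//= (bigD1 j)//=.
    by rewrite -addrA lerDl addr_ge0 ?sumr_ge0// => k _; rewrite sqr_ge0.
  under eq_integral do rewrite mul0mx dotv0l mulr0 addr0.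
  by rewrite mul0mx dotv0l mulr0 addr0 mul1r.
(* The trace is only bounded by m + 1, so M may already be null; the extra factor s >= 1 is then
   harmless. *)
have [M0|MN0] := eqVneq M 0.
  apply: (le_trans (IH M v oM _)); first by rewrite M0 raddf0.
  rewrite lee_fin ler_wpM2r ?expR_ge0// exprS ler_peMl// exprn_ge0//.
  exact: ltW.
have [u [oM' trM' uu M'u normE]] := orthproj_peel oM MN0.
set M' := M - u *m u^T in oM' trM' M'u normE *.
have q0 : 0 <= 1 - s ^- 2.
  by rewrite subr_ge0 invf_le1 ?exprn_gt0// exprn_ege1.
pose b := Num.sqrt (1 - s ^- 2).
have bb : b ^+ 2 = 1 - s ^- 2 by rewrite sqr_sqrtr.
pose A w := dotv v (z w) + (1 - s ^- 2) / 2 * dotv (M' *m z w) (M' *m z w).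
pose B w := dotv u (z w).
have mB : measurable_fun setT B by apply: measurable_dotv.
have mA : measurable_fun setT A.
  apply: measurable_funD; first exact: measurable_dotv.
  by apply: measurable_funM => //; apply: measurable_dotv; exact: measurable_mulmx.
pose f (a : Omega * R) := (normal_pdf 0 1 a.2 * expR (A a.1 + b * B a.1 * a.2))%:E.
have mf : measurable_fun setT f.
  apply/measurable_EFinP; apply: measurable_funM.
    by apply: measurableT_comp => //; exact: measurable_normal_pdf.
  apply: measurableT_comp => //; apply: measurable_funD.
    exact: measurableT_comp.
  by apply: measurable_funM => //; apply: measurable_funM => //; exact: measurableT_comp.
have f0 a : (0 <= f a)%E by rewrite lee_fin mulr_ge0 ?normal_pdf_ge0 ?expR_ge0.
have -> : (\int[P]_w (expR (dotv v (z w)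
       + (1 - s ^- 2) / 2 * dotv (M *m z w) (M *m z w)))%:E
    = \int[P]_w \int[lebesgue_measure]_x f (w, x))%E.
  apply: eq_integral => w _.
  (* At s = 1 the formula is the standard Gaussian exponential moment exp(c^2 / 2), here with c = b
     (u.z). *)
  have := @gauss_exp_quad R 1 (b * B w) ltr01.
  rewrite !expr1n invr1 subrr !mul0r mul1r mul1r => G.
  transitivity ((expR (A w))%:E * (expR ((b * B w) ^+ 2 / 2))%:E)%E.
    by rewrite -EFinM -expRD; congr (expR _)%:E; rewrite normE exprMn bb /A /B; ring.
  rewrite -G -ge0_integralZl_EFin ?expR_ge0//.
  - by apply: eq_integral => x _; rewrite -EFinM mulrCA -expRD mul0r addr0.
  - by move=> x _; rewrite lee_fin mulr_ge0 ?normal_pdf_ge0 ?expR_ge0.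
  - apply/measurable_EFinP/measurable_funM; first exact: measurable_normal_pdf.
    by apply: measurableT_comp => //; apply: measurable_funD => //; apply: measurable_funM.
rewrite (@fubini_tonelli _ _ _ _ _ P lebesgue_measure f mf f0).
(* At fixed x the linear factor shifts [v] to [v + (b * x) *: u], and [M' *m u = 0] keeps this shift
   out of the quadratic term of the bound. *)
have inner x : (\int[P]_w f (w, x) <= (s ^+ m * expR (dotv v v / 2
     + (s ^+ 2 - 1) / 2 * dotv (M' *m v) (M' *m v)) *
     (normal_pdf 0 1 x * expR (b * dotv u v * x + (1 - s ^- 2) / 2 * x ^+ 2)))%:E)%E.
  have -> : (\int[P]_w f (w, x) = (normal_pdf 0 1 x)%:E *
      \int[P]_w (expR (dotv (v + (b * x) *: u) (z w)
       + (1 - s ^- 2) / 2 * dotv (M' *m z w) (M' *m z w)))%:E)%E.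
    rewrite -ge0_integralZl_EFin ?normal_pdf_ge0//.
    + apply: eq_integral => w _; rewrite /f -EFinM; congr (_ * expR _)%:E.
      by rewrite dotvDl dotvZl /A /B /=; ring.
    + apply/measurable_EFinP; apply: measurableT_comp => //; apply: measurable_funD.
        exact: measurable_dotv.
      by apply: measurable_funM => //; apply: measurable_dotv; exact: measurable_mulmx.
  have trM'm : \tr M' <= m%:R by rewrite trM' lerBlDr -natr1 in trM *.
  apply: (le_trans (lee_wpmul2l _ (IH M' (v + (b * x) *: u) oM' trM'm))).
    by rewrite lee_fin normal_pdf_ge0.
  rewrite -EFinM lee_fin mulmxDr -scalemxAr M'u scaler0 addr0.
  rewrite [leLHS]mulrCA -!mulrA ler_pM2l ?exprn_gt0// [leRHS]mulrCA.
  rewrite -expRD ler_wpM2l ?normal_pdf_ge0// ler_expR !dotv_lin uu (dotvC v u).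
  by rewrite -bb le_eqVlt; apply/orP; left; apply/eqP; field.
have mpdf : measurable_fun setT (fun x => normal_pdf 0 1 x *
    expR (b * dotv u v * x + (1 - s ^- 2) / 2 * x ^+ 2)).
  apply: measurable_funM; first exact: measurable_normal_pdf.
  apply: measurableT_comp => //; apply: measurable_funD; first exact: measurable_funM.
  by apply: measurable_funM => //; exact: measurable_funX.
apply: (@le_trans _ _ (\int[lebesgue_measure]_x
    ((s ^+ m * expR (dotv v v / 2 + (s ^+ 2 - 1) / 2 * dotv (M' *m v) (M' *m v)))%:E *
     (normal_pdf 0 1 x * expR (b * dotv u v * x + (1 - s ^- 2) / 2 * x ^+ 2))%:E))%E).
  apply: ge0_le_integral => //.
  - by move=> x _; apply: integral_ge0 => w _.
  - exact: measurable_fun_fubini_tonelli_G.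
  - by apply/measurable_EFinP; apply: measurable_funM.
rewrite ge0_integralZl_EFin//.
(* The integral over x supplies the missing factor s and, as s^2 b^2 = s^2 - 1, the part of |M v|^2
   along u. *)
- rewrite gauss_exp_quad// -EFinM lee_fin (exprSr s m) -!mulrA ler_pM2l ?exprn_gt0//.
  rewrite [leLHS]mulrCA ler_pM2l// -expRD ler_expR normE.
  have sb : s ^+ 2 - 1 = s ^+ 2 * b ^+ 2.
    by rewrite bb mulrBr mulr1 divff// expf_neq0// gt_eqF.
  by rewrite sb le_eqVlt; apply/orP; left; apply/eqP; field.
- by move=> x _; rewrite lee_fin mulr_ge0 ?normal_pdf_ge0 ?expR_ge0.
- exact/measurable_EFinP.
- by rewrite mulr_ge0 ?expR_ge0 ?exprn_ge0 ?ltW.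
Qed.

End SubGaussian.

(** * Q-aggregation *)

Section QAggregation.
Context {R : realType} {n M : nat}.
Variables (m : 'I_M -> 'cV[R]_n) (pen : 'I_M -> R).
Implicit Types (th : 'rV[R]_M) (y mu xi : 'cV[R]_n).

Let mean th := \sum_(k < M) th 0 k *: m k.

Let crit y th :=
  norm2 (mean th - y) ^+ 2
  + 2^-1 * \sum_(k < M) th 0 k * norm2 (m k - mean th) ^+ 2
  + \sum_(k < M) th 0 k * pen k.

Let dot_mean th v : \sum_(k < M) th 0 k * dotv (m k) v = dotv (mean th) v.
Proof. by rewrite dotv_suml; apply: eq_bigr => k _; rewrite dotvZl. Qed.

Let sum_simplex th a v b : simplex th ->
  \sum_(k < M) th 0 k * (a * dotv (m k) (m k) + dotv (m k) v + b)
  = a * (\sum_(k < M) th 0 k * dotv (m k) (m k)) + dotv (mean th) v + b.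
Proof.
case=> th1 _; under eq_bigr do rewrite !mulrDr.
rewrite !big_split /= dot_mean -mulr_suml th1 mul1r mulr_sumr.
by congr (_ + _ + _); apply: eq_bigr => k _; rewrite mulrCA.
Qed.

(** By the bias-variance identity, half of |mean - y|^2 merges with the variance term: the criterion
    is a convex quadratic in the mean plus a linear function of th. *)
Let critE y th : simplex th ->
  crit y th = 2^-1 * norm2 (mean th - y) ^+ 2
  + \sum_(k < M) th 0 k * (2^-1 * norm2 (m k - y) ^+ 2 + pen k).
Proof.
move=> sth; under [in RHS]eq_bigr do rewrite mulrDr.
rewrite big_split /= /crit.
have sqE w : \sum_(k < M) th 0 k * norm2 (m k - w) ^+ 2 =
    \sum_(k < M) th 0 k * dotv (m k) (m k) - 2 * dotv (mean th) w + dotv w w.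
  rewrite -[X in X - _]mul1r -mulNr -dotvZr -sum_simplex//.
  apply: eq_bigr => k _; rewrite norm2_sqr !dotv_lin (dotvC w); congr (_ * _).
  by ring.
under [in RHS]eq_bigr do rewrite mulrCA.
rewrite -mulr_sumr !sqE norm2_sqr !dotv_lin (dotvC y).
by field.
Qed.

Lemma qagg_oracle mu xi th : simplex th ->
  (forall th', simplex th' -> crit (mu + xi) th <= crit (mu + xi) th') ->
  forall j, norm2 (mean th - mu) ^+ 2 <= norm2 (m j - mu) ^+ 2 + pen j
    + \sum_(k < M) th 0 k *
        (2 * dotv xi (m k - m j) - 2^-1 * norm2 (m k - m j) ^+ 2 - pen k).
Proof.
move=> sth thmin j; set y := mu + xi.
pose c k := 2^-1 * norm2 (m k - y) ^+ 2 + pen k.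
pose S := \sum_(k < M) th 0 k * c k.
pose q := dotv (m j - mean th) (m j - mean th).
pose a := dotv (mean th - y) (m j - mean th) + c j - S.
have q0 : 0 <= q by exact: dotv_ge0.
(* Moving th by e towards vertex j changes the criterion by e (a + e q / 2): [a] is the directional
   derivative at th. *)
have var e : 0 < e <= 1 -> 0 <= e * (a + e * q / 2).
  move=> /andP[e0 e1]; pose th' := (1 - e) *: th + e *: delta_mx 0 j.
  have sumE (F : 'I_M -> R) :
      \sum_(k < M) th' 0 k * F k = (1 - e) * (\sum_(k < M) th 0 k * F k) + e * F j.
    have -> : F j = \sum_(k < M) (delta_mx 0 j : 'rV[R]_M) 0 k * F k.
      rewrite (bigD1 j)//= mxE !eqxx mul1r big1 ?addr0// => k kj.
      by rewrite mxE (negbTE kj) andbF mul0r.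
    rewrite !mulr_sumr -big_split; apply: eq_bigr => k _ /=.
    by rewrite !mxE mulrDl !mulrA.
  have meanE : mean th' = mean th + e *: (m j - mean th).
    apply/colP => i; rewrite /mean summxE.
    under eq_bigr do rewrite mxE.
    rewrite sumE !mxE !summxE; under [in RHS]eq_bigr do rewrite mxE.
    by ring.
  have sth' : simplex th'.
    split; last first.
      move=> k; rewrite !mxE addr_ge0 ?mulr_ge0//; [by lra| by case: sth |by lra].
    under eq_bigr do rewrite -[th' _ _]mulr1.
    rewrite sumE; under eq_bigr do rewrite mulr1.
    by case: sth => -> _; ring.
  have := thmin _ sth'; rewrite !critE// sumE meanE.
  rewrite -/y -[X in _ <= _ + ((1 - e) * X + _)]/S -[X in _ + X <= _]/S -/(c j) /a.
  have -> : mean th + e *: (m j - mean th) - y = (mean th - y) + e *: (m j - mean th).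
    by rewrite addrAC.
  rewrite !norm2_sqr [dotv (_ + _ *: _) _]dotvDl !(dotvDr _ _ (e *: _)).
  rewrite !dotvZl !dotvZr -/q (dotvC (m j - mean th)).
  by nra.
have {var}a0 : 0 <= a.
  rewrite leNgt; apply/negP => a0; have qa : 0 < q - a by lra.
  (* If a < 0, this step makes the change negative; dividing by q - a rather than q allows q = 0. *)
  have /var : 0 < - a / (q - a) <= 1.
    by rewrite divr_gt0 ?oppr_gt0// ler_pdivrMr// mul1r; lra.
  rewrite pmulr_rge0 ?divr_gt0 ?oppr_gt0//.
  have -> : a + - a / (q - a) * q / 2 = a * (q - 2 * a) / (2 * (q - a)).
    by field; rewrite gt_eqF.
  by rewrite leNgt pmulr_llt0 ?invr_gt0 ?nmulr_rlt0//; lra.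
(* Adding [c k] cancels the square of [m k], so the average depends on th only through its mean and
   S. *)
have E : \sum_(k < M) th 0 k *
    (2 * dotv xi (m k - m j) - 2^-1 * norm2 (m k - m j) ^+ 2 - pen k) =
    - S + \sum_(k < M) th 0 k * (dotv (m k) (2 *: xi + m j - y)
       + (2^-1 * dotv y y - 2 * dotv xi (m j) - 2^-1 * dotv (m j) (m j))).
  clearbody y; rewrite -sumrN -big_split; apply: eq_bigr => k _ /=.
  rewrite /c !norm2_sqr !dotv_lin (dotvC xi (m k)) (dotvC y (m k)) (dotvC (m j) (m k)).
  by field.
have := @sum_simplex th 0 (2 *: xi + m j - y)
  (2^-1 * dotv y y - 2 * dotv xi (m j) - 2^-1 * dotv (m j) (m j)) sth.
under eq_bigr do rewrite mul0r add0r.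
rewrite E mul0r add0r => ->.
(* The right side minus the left side is now exactly [a]. *)
move: a0; rewrite /a /c !norm2_sqr /y !dotv_lin.
rewrite (dotvC mu (m j)) (dotvC mu (mean th)) (dotvC xi (m j)) (dotvC xi (mean th)).
rewrite (dotvC xi mu).
by lra.
Qed.

End QAggregation.

(** With u = Pk xi, v = Pj xi and a = (Pk - Pj) mu, the right side exceeds the left by |u - v +
    a/2|^2 + |u + v|^2 / 2. *)
Lemma proj_pair_bound {R : realType} {n : nat} (Pk Pj : 'M[R]_n) (mu xi : 'cV[R]_n) :
  orthproj Pk -> orthproj Pj ->
  2 * dotv xi (Pk *m (mu + xi) - Pj *m (mu + xi))
    - 2^-1 * norm2 (Pk *m (mu + xi) - Pj *m (mu + xi)) ^+ 2
    + dotv (Pj *m xi) (Pj *m xi)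
  <= 3 * dotv (Pk *m xi) (Pk *m xi) + 2 * dotv ((Pk - Pj) *m mu) xi
    - 4^-1 * dotv ((Pk - Pj) *m mu) ((Pk - Pj) *m mu).
Proof.
move=> ok oj; have dk := dotv_proj xi ok; have dj := dotv_proj xi oj.
have -> : Pk *m (mu + xi) - Pj *m (mu + xi) = (Pk - Pj) *m mu + (Pk *m xi - Pj *m xi).
  by rewrite !mulmxDr opprD addrACA mulmxBl.
move: (Pk *m xi) (Pj *m xi) ((Pk - Pj) *m mu) dk dj => u v a dk dj.
have := dotv_ge0 (u - v + 2^-1 *: a); have := dotv_ge0 (u + v).
rewrite norm2_sqr !dotv_lin.
rewrite (dotvC v u) (dotvC a u) (dotvC a v) (dotvC xi u) (dotvC xi v) (dotvC xi a).
rewrite dk dj; lra.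
Qed.

(** * Prior weights and supports along the Lasso path *)

Section Weights.
Context {R : realType} {p : nat}.
Implicit Types S : {set 'I_p}.

Lemma expR1_gt2 : 2 < expR 1 :> R.
Proof. by have := @expR_gt1Dx R 1 (oner_neq0 _); lra. Qed.

Lemma Hp_geometric : @Hp R p = \sum_(k < p.+1) expR (- k%:R) :> R.
Proof.
rewrite /Hp; apply/eqP; have e2 := expR1_gt2.
rewrite eq_sym -(can2_eq (mulfK _) (mulfVK _)); last 2 first.
- by rewrite gt_eqF//; lra.
- by rewrite gt_eqF//; lra.
apply/eqP; elim: (p) => [|m IH].
  by rewrite big_ord1 oppr0 expR0 mul1r.
rewrite big_ord_recr /= mulrDl IH.
have -> : expR (- m%:R) = expR 1 * expR (- m.+1%:R) :> R.
  by rewrite -expRD -natr1; congr expR; ring.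
by ring.
Qed.

Lemma Hp_ge1 : 1 <= @Hp R p :> R.
Proof.
rewrite Hp_geometric big_ord_recl oppr0 expR0 lerDl.
by apply: sumr_ge0 => k _; exact: expR_ge0.
Qed.

Lemma ln_Hp_le : ln (@Hp R p) <= 2^-1 :> R.
Proof.
have e2 := expR1_gt2; have H1 := Hp_ge1.
rewrite -ler_expR lnK; last by rewrite qualifE /=; lra.
(* It suffices that u = sqrt e satisfies u^2 - u - 1 >= 0: the bound
   u >= (1 + 1/16)^8 > 1.62 exceeds the golden ratio. *)
have -> : expR 2^-1 = expR 16^-1 ^+ 8 :> R by rewrite -expRM_natl; congr expR; field.
have -> : @Hp R p = (expR 16^-1 ^+ 16 - expR (- p%:R)) / (expR 16^-1 ^+ 16 - 1) :> R.
  by rewrite /Hp -expRM_natl; congr ((expR _ - _) / (expR _ - 1)); field.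
have : 17 / 16 <= expR 16^-1 :> R by have := @expR_ge1Dx R 16^-1; lra.
move: (expR 16^-1) => t t1; have := expR_gt0 (- p%:R : R); move: (expR _) => e e0.
have t8 : (17 / 16) ^+ 8 <= t ^+ 8 by apply: lerXn2r => //; rewrite qualifE /=; lra.
have {}t8 : 162 / 100 <= t ^+ 8 by apply: le_trans t8; rewrite !exprS expr0; lra.
rewrite -[16%N]/(8 * 2)%N exprM; move: (t ^+ 8) t8 => u u1.
have uu : 0 <= u ^+ 2 - u - 1 by nra.
have : 0 <= u * (u ^+ 2 - u - 1) by rewrite mulr_ge0//; lra.
by rewrite ler_pdivrMr; lra.
Qed.

Lemma weight_gt0 S : 0 < weight S :> R.
Proof.
rewrite invr_gt0 !mulr_gt0 ?expR_gt0 ?ltr0n ?bin_gt0//.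
by rewrite -[leqRHS](card_ord p) max_card.
Qed.

(** The supports of cardinality k have total weight exp(-k) / Hp, and Hp is the geometric sum of
    these exponentials. *)
Lemma sum_weight : \sum_(S : {set 'I_p}) weight S = 1 :> R.
Proof.
pose f (k : nat) : R := (@Hp R p * 'C(p, k)%:R * expR k%:R)^-1.
have cardlt S : (#|S| < p.+1)%N by rewrite ltnS -[leqRHS](card_ord p) max_card.
rewrite (partition_big (fun S => Ordinal (cardlt S)) xpredT)//=.
have H0 : @Hp R p != 0 :> R by rewrite gt_eqF// (lt_le_trans _ Hp_ge1).
apply: (mulfI H0); rewrite mulr1 mulr_sumr [RHS]Hp_geometric.
apply: eq_bigr => k _.
rewrite (eq_bigr (fun=> f k)) => [|S /eqP <-//]; rewrite sumr_const.
have -> : #|[pred S : {set 'I_p} | Ordinal (cardlt S) == k]| = 'C(p, k).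
  transitivity #|[set S : {set 'I_p} | #|S| == k]%SET|; last by rewrite card_draws card_ord.
  by apply: eq_card => S; rewrite !inE -val_eqE.
rewrite -[f k *+ _]mulr_natl expRN /f; have C0 : 'C(p, k)%:R != 0 :> R.
  by rewrite pnatr_eq0 -lt0n bin_gt0 -ltnS.
have E0 : expR k%:R != 0 :> R by rewrite gt_eqF ?expR_gt0.
move: ('C(p, k)%:R) (expR k%:R) (@Hp R p) C0 E0 H0 => c e h c0 e0 h0.
by field; rewrite c0 e0 h0.
Qed.

Lemma ln_weightE S :
  ln (1 / weight S) = ln (@Hp R p) + ln 'C(p, #|S|)%:R + #|S|%:R :> R.
Proof.
have H0 : 0 < @Hp R p :> R by have := Hp_ge1; lra.
have C0 : 0 < 'C(p, #|S|)%:R :> R.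
  by rewrite ltr0n bin_gt0 -[leqRHS](card_ord p) max_card.
by rewrite div1r invrK !lnM ?expRK// ?qualifE /= ?mulr_gt0 ?expR_gt0.
Qed.

(** This lets the penalty absorb the |S| term coming from the exponential moment. *)
Lemma ln_weight_ge S : #|S|%:R <= ln (1 / weight S) :> R.
Proof.
rewrite ln_weightE lerDr addr_ge0// ln_ge0 ?Hp_ge1//.
by rewrite ler1n bin_gt0 -[leqRHS](card_ord p) max_card.
Qed.

(** One term of the exponential series gives k^k <= e^k k!, and C(p,k) k! is a falling factorial, at
    most p^k; hence C(p,k) <= (ep/k)^k. *)
Lemma ln_bin_le k : (k <= p)%N ->
  ln 'C(p, k)%:R <= k%:R * ln (expR 1 * p%:R / (maxn k 1)%:R) :> R.
Proof.
case: k => [|k] kp; first by rewrite bin0 ln1 mul0r.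
rewrite (maxn_idPl _)//; have p0 : (0 < p)%N by exact: leq_trans kp.
have k0 : 0 < k.+1%:R :> R by rewrite ltr0n.
have q0 : 0 < expR 1 * p%:R / k.+1%:R :> R.
  by rewrite divr_gt0 ?mulr_gt0 ?expR_gt0 ?ltr0n.
rewrite mulr_natl -lnXn// ler_ln ?qualifE /= ?exprn_gt0 ?ltr0n ?bin_gt0//.
rewrite expr_div_n ler_pdivlMr ?exprn_gt0// exprMn -expRM_natl mulr1.
have kk : k.+1%:R ^+ k.+1 <= expR k.+1%:R * k.+1`!%:R :> R.
  rewrite -ler_pdivrMr ?ltr0n ?fact_gt0//.
  by have := @expR_ge1Dxn R k.+1%:R k (ltW k0); lra.
apply: (le_trans (ler_wpM2l _ kk)); first exact: ler0n.
rewrite mulrCA ler_pM2l ?expR_gt0// -natrM bin_ffact -natrX ler_nat ffact_prod.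
apply: (@leq_trans (\prod_(i < k.+1) p)%N).
  by apply: leq_prod => i _; exact: leq_subr.
by rewrite prod_nat_const card_ord.
Qed.

(** The factor 2 counts the binomial term and |S| itself, the logarithm being at least 1 for a
    nonempty S since |S| <= p. *)
Lemma ln_weight_le S :
  ln (1 / weight S) <=
    2^-1 + 2 * (#|S|%:R * ln (expR 1 * p%:R / (maxn #|S| 1)%:R)) :> R.
Proof.
have kp : (#|S| <= p)%N by rewrite -[leqRHS](card_ord p) max_card.
have HL := ln_Hp_le; have CL := ln_bin_le kp; rewrite ln_weightE.
suff : #|S|%:R <= #|S|%:R * ln (expR 1 * p%:R / (maxn #|S| 1)%:R) :> R by lra.
move: #|S| kp {CL} => [|k] kp; first by rewrite mul0r.
rewrite (maxn_idPl _)// ler_peMr// -mulrA lnM ?qualifE /= ?expR_gt0//.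
- by rewrite expRK lerDl ln_ge0// ler_pdivlMr ?ltr0n// mul1r ler_nat.
- by rewrite divr_gt0 ?ltr0n// (leq_trans _ kp).
Qed.

End Weights.

(** * Every Lasso support occurs at a knot *)

Section LassoPath.
Context {R : realType} {n p : nat} (n0 : (0 < n)%N).
Variables (X : 'M[R]_(n, p)) (y : 'cV[R]_n).

Lemma norm1_eq0 (b : 'cV[R]_p) : norm1 b = 0 -> b = 0.
Proof.
move=> /eqP; rewrite psumr_eq0// => /allP b0; apply/colP => i; rewrite mxE.
by have := b0 i (mem_index_enum i); rewrite /= normr_eq0 => /eqP.
Qed.

(* Both 0 and b minimize the objective at l0; strict convexity in the fitted
   vector, tested at b / 2, gives X *m b = 0. *)
Lemma lasso_null_lower_endpoint (l0 : R) (b : 'cV[R]_p) : 0 < l0 ->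
  (forall l, l0 < l -> lasso_sol X y l 0) -> lasso_sol X y l0 b -> b = 0.
Proof.
move=> l00 null bsol; set N := norm1 b.
have N0 : 0 <= N by apply: sumr_ge0.
have norm10 : norm1 (0 : 'cV[R]_p) = 0.
  by rewrite /norm1 big1// => i _; rewrite mxE normr0.
pose c : R := (2 * n%:R)^-1.
have c0 : 0 < c by rewrite invr_gt0 mulr_gt0 ?ltr0n.
pose F b := c * norm2 (y - X *m b) ^+ 2.
have obj0 l : lasso_obj X y l 0 = F 0 by rewrite /lasso_obj norm10 mulr0 addr0.
have le1 : F b + l0 * N <= F 0 by have := bsol 0; rewrite obj0.
(* Optimality of 0 passes to the limit at l0: e is small enough that e N stays below the supposed
   gap, and N + 1 avoids a null denominator. *)
have le2 : F 0 <= F b + l0 * N.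
  rewrite leNgt; apply/negP => lt; pose e := (F 0 - (F b + l0 * N)) / (N + 1).
  have e0 : 0 < e by rewrite divr_gt0 ?subr_gt0// ltr_wpDl.
  have : F 0 <= F b + (l0 + e) * N.
    have := null (l0 + e); rewrite ltrDl => /(_ e0 b).
    by rewrite obj0.
  have : e * (N + 1) = F 0 - (F b + l0 * N) by rewrite divfK// gt_eqF// ltr_wpDl.
  by nra.
have normZ : norm1 (2^-1 *: b) = 2^-1 * N.
  rewrite /N /norm1 mulr_sumr; apply: eq_bigr => i _.
  by rewrite mxE normrM ger0_norm.
have := bsol (2^-1 *: b); rewrite /lasso_obj normZ -/N -/c -/(F b).
have -> : c * norm2 (y - X *m (2^-1 *: b)) ^+ 2 =
    2^-1 * F 0 + 2^-1 * F b - 4^-1 * c * dotv (X *m b) (X *m b).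
  rewrite /F mulmx0 subr0 -scalemxAr !norm2_sqr !dotv_lin (dotvC y (X *m b)).
  by field.
move=> mid; have Xb0 : X *m b = 0.
  apply: dotv_eq0; apply/eqP; rewrite eq_le dotv_ge0 andbT.
  by rewrite -(pmulr_rle0 _ c0); lra.
have Fb : F b = F 0 by rewrite /F Xb0 mulmx0.
have l0N : l0 * N = 0 by lra.
by apply: norm1_eq0; apply/eqP; move/eqP: l0N; rewrite mulf_eq0 gt_eqF.
Qed.

(** Above the largest knot the support is empty; it belongs to the family because the solution at
    that knot is null too. *)
Lemma supp_in_knot_supports (beta : R -> 'cV[R]_p) (K : nat) (lam : nat -> R) :
  (forall l, 0 <= l -> lasso_sol X y l (beta l)) -> lasso_knots beta K lam ->
  forall l, 0 < l -> supp (beta l) \in knot_supports beta K lam.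
Proof.
move=> sol [K0 lamK dec null cst].
have knot k : (k <= K)%N -> supp (beta (lam k)) \in knot_supports beta K lam.
  by move=> kK; apply/imsetP; exists (Ordinal (kK : (k < K.+1)%N)).
have lam0 : 0 < lam 0%N.
  suff H i : (i < K)%N -> 0 < lam (K - i.+1)%N.
    by have := H K.-1; rewrite prednK// subnn; exact.
  elim: i => [|i IH] iK.
    by have := dec K.-1; rewrite subn1 prednK// lamK; exact.
  have := dec (K - i.+2)%N; rewrite ltn_subrL K0 -subSn// subSS => /(_ isT).
  by apply: lt_trans; apply: IH; exact: ltnW.
have beta0 : beta (lam 0%N) = 0.
  apply: (@lasso_null_lower_endpoint (lam 0%N)) => //; last exact: sol (ltW lam0).
  by move=> l ll; rewrite -(null l ll); apply: sol; lra.
move=> l l0; have [ll|ll] := ltP (lam 0%N) l.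
  by rewrite null// -beta0; exact: knot.
have [k [kK lk kl]] : exists k, [/\ (k < K)%N, lam k.+1 < l & l <= lam k].
  (* Induction on the distance i to the last knot [lam K = 0] locates the half-open interval
     containing l. *)
  suff H i : (i <= K)%N -> l <= lam (K - i)%N ->
      exists k, [/\ (k < K)%N, lam k.+1 < l & l <= lam k].
    by apply: (H K) => //; rewrite subnn.
  elim: i => [|i IH] iK; first by rewrite subn0 lamK leNgt l0.
  have [lt _|ge] := leP l (lam (K - i)%N); first exact: IH (ltnW iK) lt.
  by exists (K - i.+1)%N; split; rewrite ?ltn_subrL ?(leq_ltn_trans _ iK)// -subSn// subSS.
move: kl; rewrite le_eqVlt => /predU1P[->|kl]; first exact: knot (ltnW kK).
by case: (cst k kK) => ->; rewrite ?lk ?kl//; apply: knot => //; exact: ltnW.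
Qed.

End LassoPath.

(** * The oracle inequality *)

Section PairNoise.
Context {R : realType} {n p : nat}.
Variables (X : 'M[R]_(n, p)) (mu : 'cV[R]_n) (sigma : R) (sigma0 : 0 < sigma).
Implicit Types (S T : {set 'I_p}).

Definition pair_bias S T : 'cV[R]_n := (projS X S - projS X T) *m mu.

(** The upper bound of [proj_pair_bound]. *)
Definition pair_noise (xi : 'cV[R]_n) S T : R :=
  3 * dotv (projS X S *m xi) (projS X S *m xi) + 2 * dotv (pair_bias S T) xi
  - 4^-1 * dotv (pair_bias S T) (pair_bias S T).

(** The shift by |S| / 2 offsets the exponential moment of the noise, leaving a mean of at most the
    product of the weights. *)
Definition pair_exp (xi : 'cV[R]_n) S T : R :=
  weight S * weight T *
  expR ((16 * sigma ^+ 2)^-1 * pair_noise xi S T - 2^-1 * #|S|%:R).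

Lemma pair_exp_ge0 xi S T : 0 <= pair_exp xi S T.
Proof. by rewrite !mulr_ge0 ?expR_ge0 ?(ltW (weight_gt0 _)). Qed.

(** Each nonnegative term is below the whole sum; taking logarithms turns the two weights into
    penalties. *)
Lemma pair_noise_le (xi : 'cV[R]_n) (x : R) S T :
  \sum_S \sum_T pair_exp xi S T < expR x ->
  pair_noise xi S T <= 16 * sigma ^+ 2 * (x + ln (1 / weight S) + ln (1 / weight T))
    + 8 * sigma ^+ 2 * #|S|%:R.
Proof.
move=> sum_lt.
have {sum_lt} : pair_exp xi S T <= expR x.
  apply: le_trans (ltW sum_lt); rewrite (bigD1 S)//= (bigD1 T)//= -addrA lerDl.
  rewrite addr_ge0// sumr_ge0// => *; first exact: pair_exp_ge0.
  by apply: sumr_ge0 => *; exact: pair_exp_ge0.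
have wpos (U : {set 'I_p}) : 0 < 1 / weight U :> R by rewrite divr_gt0 ?weight_gt0.
have wE (U : {set 'I_p}) : weight U = expR (- ln (1 / weight U)) :> R.
  by rewrite expRN lnK ?qualifE//= div1r invrK.
rewrite /pair_exp {1}(wE S) {1}(wE T) -!expRD ler_expR.
have s0 : 0 < 16 * sigma ^+ 2 by rewrite mulr_gt0 ?exprn_gt0.
set t := _^-1 * pair_noise xi S T => ht.
have -> : pair_noise xi S T = 16 * sigma ^+ 2 * t by rewrite mulVKf// gt_eqF.
have : 16 * sigma ^+ 2 * t <= 16 * sigma ^+ 2 *
    (x + ln (1 / weight S) + ln (1 / weight T) + 2^-1 * #|S|%:R).
  by rewrite ler_pM2l//; lra.
by lra.
Qed.

Lemma muQ_risk_le (xi : 'cV[R]_n) (s2 x : R) (F : {set {set 'I_p}})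
    (muq : 'cV[R]_n) (b : 'cV[R]_p) :
  sigma ^+ 2 <= s2 -> 0 < x -> \sum_S \sum_T pair_exp xi S T < expR x ->
  is_muQ X (mu + xi) F s2 muq -> supp b \in F ->
  norm2 (muq - mu) ^+ 2 <= norm2 (X *m b - mu) ^+ 2
    + s2 * (24 + 96 * (norm0 b)%:R * ln (expR 1 * p%:R / (maxn (norm0 b) 1)%:R))
    + 22 * sigma ^+ 2 * x.
Proof.
move=> s2ge x0 /pair_noise_le noise [th [sth thmin ->]] bF.
pose L (S : {set 'I_p}) : R := ln (1 / weight S).
pose pen (k : 'I_#|F|) := 26 * s2 * L (enum_val k).
have penE th' : \sum_(k < #|F|) th' 0 k * pen k =
    26 * s2 * \sum_(k < #|F|) th' 0 k * L (enum_val k) :> R.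
  by rewrite mulr_sumr; apply: eq_bigr => k _; rewrite /pen mulrCA.
pose j := enum_rank_in bF (supp b).
have jE : enum_val j = supp b by rewrite enum_rankK_in.
have := @qagg_oracle R n #|F| (muj X (mu + xi) (F := F)) pen mu xi th sth _ j.
move=> /(_ _)/wrap[]; first by move=> th' sth'; rewrite !penE; exact: thmin.
rewrite -/(mutheta X (mu + xi) th) => /le_trans; apply.
set P := projS X (supp b); have oP : orthproj P by exact: projS_orthproj.
have s0 : 0 < sigma ^+ 2 by rewrite exprn_gt0.
(* On the side of S the noise costs 16 sigma^2 L + 8 sigma^2 |S| <= 24 sigma^2 L, which the penalty
   26 s2 L covers. *)
have term (k : 'I_#|F|) :
    2 * dotv xi (muj X (mu + xi) k - muj X (mu + xi) j)
      - 2^-1 * norm2 (muj X (mu + xi) k - muj X (mu + xi) j) ^+ 2 - pen k <=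
    16 * sigma ^+ 2 * (x + L (supp b)) - dotv (P *m xi) (P *m xi).
  have := proj_pair_bound mu xi (projS_orthproj X (enum_val k)) oP.
  have := noise (enum_val k) (supp b); rewrite /pair_noise /pair_bias -/P.
  have := ln_weight_ge (enum_val k) (R := R).
  rewrite /muj jE -/P -/(L _) -/(L _) /pen.
  move: (L (enum_val k)) (L (supp b)) => Lk Lj SL.
  have : 8 * sigma ^+ 2 * #|enum_val k|%:R <= 8 * sigma ^+ 2 * Lk.
    by rewrite ler_pM2l// mulr_gt0.
  have Lk0 : 0 <= Lk by exact: le_trans SL.
  have : sigma ^+ 2 * Lk <= s2 * Lk by rewrite ler_wpM2r.
  have : 0 <= sigma ^+ 2 * Lk by rewrite mulr_ge0// ltW.
  by lra.
have {term} : \sum_(k < #|F|) th 0 k *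
      (2 * dotv xi (muj X (mu + xi) k - muj X (mu + xi) j)
      - 2^-1 * norm2 (muj X (mu + xi) k - muj X (mu + xi) j) ^+ 2 - pen k) <=
    16 * sigma ^+ 2 * (x + L (supp b)) - dotv (P *m xi) (P *m xi).
  case: sth => th1 th0; rewrite [leRHS](_ : _ = \sum_(k < #|F|) th 0 k *
      (16 * sigma ^+ 2 * (x + L (supp b)) - dotv (P *m xi) (P *m xi))).
    by apply: ler_sum => k _; rewrite ler_wpM2l.
  by rewrite -mulr_suml th1 mul1r.
(* Bias and variance are orthogonal; the variance |P xi|^2 will cancel against the one subtracted in
   the previous bound. *)
have : norm2 (muj X (mu + xi) j - mu) ^+ 2 <=
    norm2 (X *m b - mu) ^+ 2 + dotv (P *m xi) (P *m xi).
  apply: le_trans (lerD (projS_best X mu (subxx _)) (lexx _)).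
  have : dotv (P *m mu - mu) (P *m xi) = 0.
    rewrite -(proj1 oP) -dotv_mulmx mulmxBr mulmxA.
    by case: oP => -> ->; rewrite subrr dotv0l.
  rewrite /muj jE -/P mulmxDr addrAC.
  move: (P *m mu - mu) (P *m xi) => u v uv.
  by rewrite !norm2_sqr !dotv_lin (dotvC v u) uv; lra.
(* The support of b costs at most (26 + 16) s2 L <= 48 s2 L; 48 times the bound 1/2 + 2 k l on L
   gives 24 + 96 k l. *)
have := ln_weight_le (supp b) (R := R); have := ln_weight_ge (supp b) (R := R).
rewrite /pen jE -/(L _) /norm0.
have : (0 : R) <= #|supp b|%:R by [].
move: (L _) (#|supp b|%:R) (ln _) => Lj k l k0 kL Ll.
move: (\sum_(_ < _) _) (norm2 (muj _ _ _ - _) ^+ 2) (norm2 (X *m b - mu) ^+ 2) (dotv _ _).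
move=> e1 e2 e3 e4 h1 h2.
have : sigma ^+ 2 * Lj <= s2 * Lj by rewrite ler_wpM2r// (le_trans _ kL).
have : s2 * Lj <= s2 * (2^-1 + 2 * (k * l)).
  by rewrite ler_wpM2l// (le_trans (ltW s0)).
have : 0 <= s2 * (2^-1 + 2 * (k * l)).
  by rewrite mulr_ge0 ?(le_trans _ Ll)// (le_trans _ kL, le_trans (ltW s0)).
have : 0 < sigma ^+ 2 * x by rewrite mulr_gt0.
by lra.
Qed.

Context d (Omega : measurableType d) (P : probability Omega R).
Variable xi : Omega -> 'cV[R]_n.
Hypothesis xi_meas : forall i, measurable_fun setT (fun w => xi w i 0).
Hypothesis xi_subg : forall v : 'cV[R]_n,
  (expectation P (fun w => expR (dotv v (xi w)))
    <= (expR (sigma ^+ 2 * norm2 v ^+ 2 / 2))%:E)%E.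

Lemma measurable_pair_exp S T : measurable_fun setT (fun w => pair_exp (xi w) S T).
Proof.
apply: measurable_funM => //; apply: measurableT_comp => //.
apply: measurable_funB => //; apply: measurable_funM => //.
apply: measurable_funB => //; apply: measurable_funD; apply: measurable_funM => //.
  by apply: measurable_dotv; exact: measurable_mulmx.
exact: measurable_dotv.
Qed.

Lemma integral_pair_exp_le S T :
  (\int[P]_w (pair_exp (xi w) S T)%:E <= (weight S * weight T)%:E)%E.
Proof.
have w0 : 0 <= weight S * weight T :> R by rewrite mulr_ge0// ltW// weight_gt0.
have sN0 : sigma != 0 by rewrite gt_eqF.
pose z w := sigma^-1 *: xi w.
have z_meas i : measurable_fun setT (fun w => z w i 0).
  by under eq_fun do rewrite mxE; exact: measurable_funM.
have z_subg v : (\int[P]_w (expR (dotv v (z w)))%:E <= (expR (dotv v v / 2))%:E)%E.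
  have := xi_subg (sigma^-1 *: v); rewrite unlock norm2_sqr dotvZl dotvZr.
  under eq_integral do rewrite dotvZl -dotvZr.
  by rewrite [sigma ^+ 2 * _](_ : _ = dotv v v)//; field.
(* This value makes (1 - s^-2) / 2 = 3/16, the coefficient of |Pi_S z|^2 in the exponent; likewise v
   = a / (8 sigma) matches the linear term. *)
pose s : R := Num.sqrt (8 / 5).
have ss : s ^+ 2 = 8 / 5 by rewrite sqr_sqrtr.
have s1 : 1 <= s by rewrite -sqrtr1 ler_wsqrtr//; lra.
pose Q := projS X S; pose a := pair_bias S T; pose v := (8 * sigma)^-1 *: a.
have oQ : orthproj Q by exact: projS_orthproj.
have := subgaussian_proj_mgf z_meas z_subg v s1 oQ (mxtrace_projS X S).
pose c := - ((64 * sigma ^+ 2)^-1 * dotv a a) - 2^-1 * #|S|%:R.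
have E w : pair_exp (xi w) S T = weight S * weight T * expR c *
    expR (dotv v (z w) + (1 - s ^- 2) / 2 * dotv (Q *m z w) (Q *m z w)).
  rewrite /pair_exp -[RHS]mulrA -expRD ss /pair_noise -/a -/Q; congr (_ * expR _).
  rewrite /v /z -scalemxAr !dotvZl !dotvZr /c; field.
  by rewrite sN0.
move=> mgf; under eq_integral do rewrite E EFinM.
have C0 : 0 <= weight S * weight T * expR c by rewrite mulr_ge0 ?expR_ge0.
rewrite ge0_integralZl_EFin//; last first.
  apply/measurable_EFinP; apply: measurableT_comp => //; apply: measurable_funD.
    exact: measurable_dotv.
  by apply: measurable_funM => //; apply: measurable_dotv; exact: measurable_mulmx.
apply: (le_trans (lee_wpmul2l _ mgf)); first by rewrite lee_fin.
rewrite -EFinM lee_fin -[leLHS]mulrA ler_piMr//.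
(* Indeed s <= 3/2 <= exp(1/2). *)
have sm : s ^+ #|S| <= expR (2^-1 * #|S|%:R).
  rewrite mulrC expRM_natl; apply: lerXn2r; rewrite ?nnegrE ?expR_ge0//; first by lra.
  apply: (@le_trans _ _ (3 / 2)); last by have := @expR_ge1Dx R 2^-1; lra.
  by nra.
apply: (le_trans (ler_wpM2l (expR_ge0 _) (ler_wpM2r (expR_ge0 _) sm))).
(* The exponent is at most (1/2 + 3/10 - 1) |v|^2 <= 0, as |Q v| <= |v| and the compensating term is
   -|v|^2. *)
rewrite -!expRD expR_le1 /c.
have := dotv_proj_le v oQ; have -> : dotv v v = (64 * sigma ^+ 2)^-1 * dotv a a.
  by rewrite dotvZl dotvZr; field.
have : 0 <= (64 * sigma ^+ 2)^-1 * dotv a a.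
  by rewrite mulr_ge0 ?dotv_ge0// invr_ge0 mulr_ge0// exprn_ge0// ltW.
by rewrite ss; move: ((64 * _)^-1 * _) (dotv (Q *m v) _) => K q; lra.
Qed.

Lemma pair_exp_tail x :
  (P [set w | (expR x <= \sum_S \sum_T pair_exp (xi w) S T)%R] <= (expR (- x))%:E)%E.
Proof.
pose Z w : R := \sum_S \sum_T pair_exp (xi w) S T.
have mZ : measurable_fun setT Z.
  by apply: measurable_sum => S; apply: measurable_sum => T; exact: measurable_pair_exp.
have Z0 w : 0 <= Z w.
  by apply: sumr_ge0 => S _; apply: sumr_ge0 => T _; exact: pair_exp_ge0.
have EZ : (\int[P]_w (Z w)%:E <= 1)%E.
  have -> : (\int[P]_w (Z w)%:E =
      \sum_S \sum_T \int[P]_w (pair_exp (xi w) S T)%:E)%E.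
    under eq_integral do rewrite -sumEFin.
    rewrite ge0_integral_sum//=.
    - apply: eq_bigr => S _; under eq_integral do rewrite -sumEFin.
      rewrite ge0_integral_sum//=.
      + by move=> T; apply/measurable_EFinP; exact: measurable_pair_exp.
      + by move=> T w _; rewrite lee_fin pair_exp_ge0.
    - move=> S; apply/measurable_EFinP.
      by apply: measurable_sum => T; exact: measurable_pair_exp.
    - by move=> S w _; rewrite lee_fin sumr_ge0// => T _; exact: pair_exp_ge0.
  apply: (@le_trans _ _ (\sum_S \sum_T (weight S * weight T : R)%:E)%E).
    by apply: lee_sum => S _; apply: lee_sum => T _; exact: integral_pair_exp_le.
  under eq_bigr do rewrite sumEFin -mulr_sumr sum_weight mulr1.
  by rewrite sumEFin sum_weight.
have := @le_integral_abse _ _ R P setT measurableT (EFin \o Z) (expR x) _ (expR_gt0 x).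
move=> /(_ _)/wrap[]; first exact/measurable_EFinP.
rewrite setTI; under eq_set do rewrite /= ger0_norm// lee_fin.
under eq_integral do rewrite /= ger0_norm//.
move=> /le_trans/(_ EZ); rewrite -/Z => H.
by rewrite expRN -[leRHS]mule1 lee_pdivlMl ?expR_gt0.
Qed.

End PairNoise.

(** * The high-probability event and the infimum over the tuning parameter *)

Theorem theorem2 (R : realType) (d : measure_display) (Omega : measurableType d)
    (P : probability Omega R)
    (n p : nat) (hn : (0 < n)%N) (hp : (0 < p)%N)
    (sigma : R) (hsigma : 0 < sigma)
    (mu : 'cV[R]_n) (X : 'M[R]_(n, p))
    (xi : Omega -> 'cV[R]_n)
    (xi_meas : forall i : 'I_n, measurable_fun setT (fun w => xi w i 0))
    (xi_subg : forall v : 'cV[R]_n,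
      (expectation P (fun w => expR (dotv v (xi w)))
        <= (expR (sigma ^+ 2 * norm2 v ^+ 2 / 2))%:E)%E)
    (y : Omega -> 'cV[R]_n) (hy : forall w, y w = mu + xi w)
    (sigma2hat : 'cV[R]_n -> R)
    (sigma2hat_ge0 : forall z, 0 <= sigma2hat z)
    (sigma2hat_meas : measurable_fun setT (fun w => sigma2hat (y w)))
    (betaL : 'cV[R]_n -> R -> 'cV[R]_p)
    (hbetaL : forall z l, 0 <= l -> lasso_sol X z l (betaL z l))
    (K : 'cV[R]_n -> nat) (lam : 'cV[R]_n -> nat -> R)
    (hknots : forall z, lasso_knots (betaL z) (K z) (lam z))
    (muQ : 'cV[R]_n -> 'cV[R]_n)
    (hmuQ : forall z,
      is_muQ X z (knot_supports (betaL z) (K z) (lam z)) (sigma2hat z) (muQ z))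
    (x : R) (hx : 0 < x) :
  exists A : set Omega,
    [/\ measurable A,
        (1%:E - P [set w | (sigma2hat (y w) < sigma ^+ 2)%R]
           - (2 * expR (- x))%:E < P A)%E &
        forall w, A w ->
          sqnormn (muQ (y w) - mu)
          <= inf [set lasso_risk X mu (sigma2hat (y w)) (betaL (y w) l)
                 | l in [set l : R | 0 < l]]
             + 22 * sigma ^+ 2 * x / n%:R].
Proof.
pose Z w : R := \sum_S \sum_T pair_exp X mu sigma (xi w) S T.
have mZ : measurable_fun setT Z.
  by apply: measurable_sum => S; apply: measurable_sum => T; exact: measurable_pair_exp.
pose D := [set w | sigma2hat (y w) < sigma ^+ 2].
pose B := [set w | expR x <= Z w].
have mD : measurable D.
  have -> : D = ~` (setT `&` [set w | sigma ^+ 2 <= sigma2hat (y w)]).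
    by rewrite /D setTI; apply/seteqP; split=> w /=; rewrite ltNge => /negP.
  by apply: measurableC; exact: measurable_fun_le.
have mB : measurable B.
  by rewrite -[B]setTI; exact: measurable_fun_le.
have PB : (P B <= (expR (- x))%:E)%E by exact: pair_exp_tail.
exists (~` (D `|` B)); split.
- exact/measurableC/measurableU.
(* The union bound loses only delta + exp(-x); the second exp(-x) makes the inequality strict. *)
- rewrite probability_setC; last exact: measurableU.
  have PU : (P (D `|` B) <= P D + P B)%E by exact: measureU2.
  have finP E : measurable E -> exists r : R, P E = r%:E.
    by move=> mE; exists (fine (P E)); rewrite fineK// fin_num_measure.
  have [[a aE] [b bE]] := (finP D mD, finP B mB).
  have [c cE] := finP _ (measurableU _ _ mD mB).
  move: PU PB; rewrite -/D aE bE cE -!EFinD !lee_fin !lte_fin.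
  by have := expR_gt0 (- x); lra.
move=> w /= /not_orP[] /negP; rewrite -leNgt => s2 /negP; rewrite -ltNge => Zw.
have n0 : 0 < n%:R :> R by rewrite ltr0n.
(* The set of risks must be nonempty for its infimum to be bounded below this way; l = 1 is a
   witness. *)
rewrite -lerBlDr; apply: lb_le_inf.
  by exists (lasso_risk X mu (sigma2hat (y w)) (betaL (y w) 1)), 1 => /=.
move=> _ [l /= l0 <-]; rewrite lerBlDr /lasso_risk /sqnormn.
have := @muQ_risk_le R n p X mu sigma hsigma (xi w) _ _ _ _ (betaL (y w) l) s2 hx Zw.
have := hmuQ (y w); rewrite {1}hy => hq /(_ _ _ hq).
have bF := supp_in_knot_supports hn (hbetaL (y w)) (hknots (y w)) l0.
move=> /(_ bF) risk.
have scale (a b c e f : R) : a <= b + c * e + f ->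
    n%:R^-1 * a <= n%:R^-1 * b + c / n%:R * e + f / n%:R.
  move=> le; rewrite (_ : _ + _ / _ = n%:R^-1 * (b + c * e + f)); last by ring.
  by rewrite ler_pM2l ?invr_gt0.
exact: scale.
Qed.
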